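(* Let $n\ge 1$. Every $A\in S_n$ is unitarily equivalent to a compressed multiplication operator; that is, there exists a non-trivial probability measure $\mu$ on $\partial\mathbb{D}$ such that $A$ is unitarily equivalent to $A^\mu=P_nM_zP_n\restriction\mathcal{P}_{n-1}$.
   Context: $\mathbb{D}=\{z\in\mathbb{C}:|z|<1\}$. A probability measure $\mu$ on $\partial\mathbb{D}$ is non-trivial if it is not supported on a finite set. $\mathcal{P}_{n-1}$ is the space of complex polynomials of degree at most $n-1$, viewed as an $n$-dimensional subspace of $L^2(\partial\mathbb{D},d\mu)$ with the inherited inner product; $P_n$ is the orthogonal projection of $L^2(\partial\mathbb{D},d\mu)$ onto $\mathcal{P}_{n-1}$; $M_z$ is multiplication by $z$ on $L^2(\partial\mathbb{D},d\mu)$. The compressed multiplication operator of $\mu$ (of dimension $n$) is $A^\mu=P_nM_zP_n\restriction\mathcal{P}_{n-1}$. $S_n$ is the set of operators $A$ on an $n$-dimensional complex Hilbert space such that: $A$ is a contraction ($\|A\|\le 1$); $A$ is completely non-unitary, which in finite dimension means $A$ has no eigenvalue of absolute value $1$; and $A$ has defect index $1$, i.e. $\dim\operatorname{ran}(\mathbf{1}-A^*A)=1$. *)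

(* Defs.v *)
(* R[i] is the field of complex numbers over R : realType. *)
From HB Require Import structures.
From mathcomp Require Import all_boot all_order all_algebra.
From mathcomp Require Import complex.
From mathcomp Require Import all_classical all_reals all_analysis.
From mathcomp Require Import measurable_realfun.
Set Implicit Arguments.
Unset Strict Implicit.
Unset Printing Implicit Defensive.
Import Order.TTheory GRing.Theory Num.Theory Num.Def.
Local Open Scope complex_scope.
Local Open Scope classical_set_scope.
Local Open Scope ring_scope.

Section FiniteDimensionalHilbert.
Context {C : numClosedFieldType} {H : vectType C} (dot : {dot H for conjC}).
Implicit Types A : 'End(H).

Definition hnorm (x : H) : C := sqrtC (dot x x).

(* The default value 0 is never used: see [adjointP]. *)
Definition adjoint A : 'End(H) :=
  xget 0 [set B : 'End(H) | forall x y, dot (A x) y = dot x (B y)].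

Lemma adjointP A x y : dot (A x) y = dot x (adjoint A y).
Proof.
rewrite /adjoint; case: xgetP => [B _ /(_ x y)//|noB]; exfalso.
pose e := vbasis {:H}; pose d := \dim {:H}.
have dotJ (u v : H) : dot u v = (dot v u)^*.
  by rewrite (hermC dot) expr0 mul1r.
have rowE (z : nat -> H) : exists f : 'Hom(H, 'rV[C]_d), forall u i, f u 0 i = dot u (z i).
  pose h (u : H) : 'rV[C]_d := \row_(i < d) dot u (z i).
  have lin : linear h.
    by move=> a u v; apply/rowP => i; rewrite !mxE linearPl.
  pose lin' := GRing.isLinear.Build _ _ _ _ h lin.
  by exists (linfun (HB.pack h lin' : {linear H -> 'rV[C]_d})) => u i; rewrite lfunE mxE.
have [f fE] := rowE (fun i => e`_i); have [g gE] := rowE (fun i => A e`_i).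
have f0 : lker f == 0%VS.
  apply/lker0P => u v /rowP uv.
  apply/eqP; rewrite -subr_eq0 -(dnorm_eq0 dot).
  rewrite {2}(coord_vbasis (memvf (u - v))) linear_sumr big1// => i _.
  rewrite linearZr_LR /= linearBl /=.
  by have := uv i; rewrite !fE => ->; rewrite subrr mulr0.
have fT : limg f = fullv.
  apply/eqP; rewrite eqEdim subvf limg_dim_eq ?(eqP f0) ?capv0//.
  by rewrite dimvf /dim /= mul1n.
apply: (noB (f^-1 \o g)%VF) => {}x {}y.
rewrite (coord_vbasis (memvf x)) linear_sum /= !linear_sumlz.
apply: eq_bigr => i _; rewrite linearZ /= !linearZl_LR; congr (_ * _).
apply: (etrans (dotJ _ _)); apply/esym/(etrans (dotJ _ _)); congr (_^*).
by rewrite -gE -fE comp_lfunE limg_lfunVK// fT memvf.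
Qed.

Definition contraction A := forall x, hnorm (A x) <= hnorm x.

Definition completely_non_unitary A :=
  forall z : C, passmx.leigenvalue A z -> `|z| != 1.

Definition defect_index A : nat := \dim (limg (\1 - (adjoint A \o A))%VF).

(* [H] is complete, being finite dimensional, so (H, dot) is a Hilbert space. *)
Definition in_S (n : nat) A :=
  [/\ \dim {:H} = n, contraction A, completely_non_unitary A
    & defect_index A = 1%N].

End FiniteDimensionalHilbert.

Definition unitarily_equivalent (C : numClosedFieldType) (H K : vectType C)
    (dotH : H -> H -> C) (dotK : K -> K -> C) (A : H -> H) (B : K -> K) :=
  exists U : 'Hom(H, K), [/\ bijective U,
    forall x y, dotK (U x) (U y) = dotH x y & forall x, U (A x) = B (U x)].

Section Circle.
Context {R : realType}.

Record circle := Circle { circle_val :> R[i]; _ : `|circle_val| == 1 }.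

HB.instance Definition _ := [isSub for circle_val].
HB.instance Definition _ := [Choice of circle by <:].

Fact norm1_circle : `|1 : R[i]| == 1. Proof. by rewrite normr1. Qed.
HB.instance Definition _ := isPointed.Build circle (Circle norm1_circle).

Definition circle_xy (z : circle) : measurableTypeR R * measurableTypeR R :=
  (complex.Re z, complex.Im z).

(* The Borel sigma-algebra of the unit circle, i.e. the trace of that of R^2. *)
HB.instance Definition _ :=
  Measurable.copy circle (g_sigma_algebra_preimageType circle_xy).

Lemma norm_circle (z : circle) : `|z : R[i]| = 1.
Proof. by case: z => z /= /eqP. Qed.

Lemma measurable_circle_xy : measurable_fun setT circle_xy.
Proof. by move=> _ B mB; exists B; rewrite ?setTI. Qed.

Lemma measurable_circle_Re : measurable_fun setT (fun z : circle => complex.Re z).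
Proof. exact: (measurableT_comp measurable_fst measurable_circle_xy). Qed.

Lemma measurable_circle_Im : measurable_fun setT (fun z : circle => complex.Im z).
Proof. exact: (measurableT_comp measurable_snd measurable_circle_xy). Qed.

End Circle.
Arguments circle R : clear implicits.

Section ComplexMeasurable.
Context {R : realType}.
Implicit Types f g : circle R -> R[i].

Definition Cmeasurable f :=
  measurable_fun setT (fun z => complex.Re (f z)) /\
  measurable_fun setT (fun z => complex.Im (f z)).

Lemma Cmeasurable_cst c : Cmeasurable (cst c).
Proof. by split; exact: measurable_cst. Qed.

Lemma Cmeasurable_val : Cmeasurable (@circle_val R).
Proof. split; [exact: measurable_circle_Re|exact: measurable_circle_Im]. Qed.

Lemma CmeasurableD f g : Cmeasurable f -> Cmeasurable g ->
  Cmeasurable (fun z => f z + g z).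
Proof.
move=> [fr fi] [gr gi]; split.
- rewrite (_ : (fun z => _) = (fun z => complex.Re (f z) + complex.Re (g z))).
    exact: measurable_funD.
  by apply/funext => z; case: (f z) (g z) => [? ?] [].
- rewrite (_ : (fun z => _) = (fun z => complex.Im (f z) + complex.Im (g z))).
    exact: measurable_funD.
  by apply/funext => z; case: (f z) (g z) => [? ?] [].
Qed.

Lemma CmeasurableM f g : Cmeasurable f -> Cmeasurable g ->
  Cmeasurable (fun z => f z * g z).
Proof.
move=> [fr fi] [gr gi]; split.
- rewrite (_ : (fun z => _) = (fun z => complex.Re (f z) * complex.Re (g z)
    - complex.Im (f z) * complex.Im (g z))).
    by apply: measurable_funB; exact: measurable_funM.
  by apply/funext => z; case: (f z) (g z) => [? ?] [].
- rewrite (_ : (fun z => _) = (fun z => complex.Re (f z) * complex.Im (g z)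
    + complex.Im (f z) * complex.Re (g z))).
    by apply: measurable_funD; exact: measurable_funM.
  by apply/funext => z; case: (f z) (g z) => [? ?] [].
Qed.

Lemma Cmeasurable_horner (p : {poly R[i]}) :
  Cmeasurable (fun z : circle R => p.[z]).
Proof.
elim/poly_ind: p => [|p c IH].
  by under eq_fun do rewrite horner0; exact: Cmeasurable_cst.
under eq_fun do rewrite hornerMXaddC.
apply: CmeasurableD; last exact: Cmeasurable_cst.
by apply: CmeasurableM => //; exact: Cmeasurable_val.
Qed.

(* |w|^2 as an element of R: the norm of R[i] takes its values in R[i]. *)
Definition sqnorm (w : R[i]) : R := complex.Re w ^+ 2 + complex.Im w ^+ 2.

Lemma sqnormE w : (sqnorm w)%:C = `|w| ^+ 2.
Proof. exact: add_Re2_Im2. Qed.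

Lemma sqnorm_ge0 w : 0 <= sqnorm w.
Proof. by rewrite /sqnorm addr_ge0 ?sqr_ge0. Qed.

End ComplexMeasurable.

Section CompressedMultiplication.
Context {R : realType} (mu : probability (circle R) R).
Implicit Types f g : circle R -> R[i].

Definition nontrivial :=
  ~ exists2 F : set (circle R), finite_set F & mu (~` F) = 0%E.

Definition Cintegral f : R[i] :=
  (\int[mu]_(z in setT) complex.Re (f z)) +i*
  (\int[mu]_(z in setT) complex.Im (f z)).

Definition L2dot f g : R[i] := Cintegral (fun z => f z * (g z)^*).

(* Elements of L^2(mu) are given by representatives, without identifying
   mu-a.e. equal functions: Mz preserves a.e. equality, and Pn depends on its
   argument only through integrals against mu. *)
Record L2 := MkL2 {
  L2val :> circle R -> R[i];
  L2_measurable : Cmeasurable L2val;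
  L2_finite : (\int[mu]_(z in setT) (sqnorm (L2val z))%:E < +oo)%E }.

Lemma L2_horner_finite (p : {poly R[i]}) :
  (\int[mu]_(z in setT) (sqnorm p.[z : circle R])%:E < +oo)%E.
Proof.
have [M pM] : exists M : R, forall z : circle R, sqnorm p.[z] <= M.
  pose S := \sum_(i < size p) `|p`_i|.
  exists (complex.Re (S ^+ 2)) => z.
  have pS : `|p.[z]| <= S.
    rewrite horner_coef (le_trans (ler_norm_sum _ _ _))// ler_sum// => i _.
    by rewrite normrM normrX norm_circle expr1n mulr1.
  have : `|p.[z]| ^+ 2 <= S ^+ 2 by rewrite lerXn2r// nnegrE// (le_trans _ pS).
  by rewrite -sqnormE lecE => /andP[].
have [mr mi] := Cmeasurable_horner p.
apply: (@le_lt_trans _ _ (\int[mu]_(z in setT) (cst M%:E z))%E).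
  apply: ge0_le_integral => //.
  - by move=> z _; rewrite lee_fin sqnorm_ge0.
  - by apply/measurable_EFinP/measurable_funD; exact: measurable_funX.
  - by move=> z _; rewrite lee_fin.
by rewrite integral_cst//= probability_setT mule1 ltry.
Qed.

Definition L2_of_poly (p : {poly R[i]}) : L2 :=
  MkL2 (Cmeasurable_horner p) (L2_horner_finite p).

Lemma L2_Mz_finite (f : L2) :
  (\int[mu]_(z in setT) (sqnorm ((z : R[i]) * f z))%:E < +oo)%E.
Proof.
rewrite (eq_integral (fun z => (sqnorm (f z))%:E)); first exact: L2_finite.
move=> z _; congr EFin; apply: complexI.
by rewrite !sqnormE normrM norm_circle mul1r.
Qed.

Definition Mz (f : L2) : L2 :=
  MkL2 (CmeasurableM Cmeasurable_val (L2_measurable f)) (L2_Mz_finite f).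

(* {poly_n R[i]} is the space of polynomials of degree at most n - 1. *)
Definition poly_dot n (p q : {poly_n R[i]}) : R[i] :=
  L2dot (L2_of_poly p) (L2_of_poly q).

(* The orthogonal projection of f onto {poly_n R[i]}, i.e. the p such that f - p
   is orthogonal to {poly_n R[i]}. Such a p exists, so the default 0 is not used;
   it is unique when mu is nontrivial, since poly_dot is then definite. *)
Definition Pn n (f : L2) : {poly_n R[i]} :=
  xget 0 [set p : {poly_n R[i]} | forall q : {poly_n R[i]},
    L2dot (fun z => f z - L2_of_poly p z) (L2_of_poly q) = 0].

Definition compressed_mult n (p : {poly_n R[i]}) : {poly_n R[i]} :=
  Pn n (Mz (L2_of_poly (Pn n (L2_of_poly p)))).

End CompressedMultiplication.

(* Main.v *)
(* Defect index 1 means that <x, y> - <A x, A y> = s x * conj (s y) for a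
   linear functional s.  As A has no unimodular eigenvalue, the functionals
   s o A^k, k < n, form a basis of the dual, so there is a unit vector v
   with s (A^k v) = 0 for k < n - 1 and s (A^(n-1) v) <> 0.  Then
   v, A v, ..., A^(n-1) v is a basis of H, and A is determined up to unitary
   equivalence by the moments c_k = <A^k v, v>, k <= n, since
   <A^i v, A^j v> = c_(i-j) whenever j <= n - 1 and j <= i.  So it suffices to find a
   non-trivial mu with \int z^k dmu = c_k for k <= n.

   With w = (1 - conj z A)^-1 v, the function \sum_(k in Z) c_k (conj z)^k on the circle
   equals |s w|^2, which is bounded below by the Cayley-Hamilton theorem.  As c_k
   tends to 0, its truncation g_N to |k| < N is positive for N large.  Charging
   the m-th roots of unity z with the masses g_N(z) / m gives a probability measure
   with the same moments of order < N as soon as m >= 2 N; a convex combination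
   of these measures over infinitely many m is non-trivial. *)
Require Import Defs.
From HB Require Import structures.
From mathcomp Require Import all_boot all_order all_algebra.
From mathcomp Require Import complex.
From mathcomp Require Import all_classical all_reals all_analysis.
From mathcomp Require Import measurable_realfun cyclic separable cyclotomic.
From mathcomp Require Import ring zify.
Set Implicit Arguments.
Unset Strict Implicit.
Unset Printing Implicit Defensive.
Import Order.TTheory GRing.Theory Num.Theory Num.Def.
Local Open Scope complex_scope.
Local Open Scope ring_scope.

(** * Polynomials acting on a vector space *)

Section PolynomialAction.
Context {F : fieldType} {H : vectType F} (A : 'End(H)).
Implicit Types (p q : {poly F}) (x y : H).

Definition polyact p x : H := \sum_(i < size p) p`_i *: iter i A x.

Lemma polyactE n p x : (size p <= n)%N ->
  polyact p x = \sum_(i < n) p`_i *: iter i A x.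
Proof.
move=> pn; rewrite /polyact (big_ord_widen n (fun i => p`_i *: iter i A x) pn).
rewrite big_mkcond; apply: eq_bigr => i _.
by case: ltnP => // si; rewrite nth_default ?scale0r.
Qed.

Lemma iter_linear i a x y : iter i A (a *: x + y) = a *: iter i A x + iter i A y.
Proof. by elim: i => //= i ->; rewrite linearP. Qed.

Lemma iter_lfun0 i : iter i A 0 = 0.
Proof. by elim: i => //= i ->; rewrite linear0. Qed.

Lemma polyact_semilinear a p q x :
  polyact (a *: p + q) x = a *: polyact p x + polyact q x.
Proof.
pose n := maxn (size (a *: p + q)) (maxn (size p) (size q)).
rewrite !(@polyactE n) ?leq_max ?leqnn ?orbT// scaler_sumr -big_split /=.
by apply: eq_bigr => i _; rewrite coefD coefZ scalerDl scalerA.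
Qed.

Lemma polyactC c x : polyact c%:P x = c *: x.
Proof. by rewrite (@polyactE 1) ?size_polyC ?leq_b1// big_ord1 coefC. Qed.

Lemma polyact0 x : polyact 0 x = 0.
Proof. by rewrite /polyact size_poly0 big_ord0. Qed.

Lemma polyactZ a p x : polyact (a *: p) x = a *: polyact p x.
Proof. by rewrite -[a *: p]addr0 polyact_semilinear polyact0 addr0. Qed.

Lemma polyactD p q x : polyact (p + q) x = polyact p x + polyact q x.
Proof. by rewrite -[p]scale1r polyact_semilinear !scale1r. Qed.

Lemma polyactB p q x : polyact (p - q) x = polyact p x - polyact q x.
Proof. by rewrite polyactD -scaleN1r polyactZ scaleN1r. Qed.

Lemma polyactMX p x : polyact (p * 'X) x = A (polyact p x).
Proof.
rewrite (@polyactE (size p).+1); last first.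
  by rewrite (leq_trans (size_polyMleq _ _))// size_polyX addnC.
rewrite big_ord_recl coefMX eqxx scale0r add0r linear_sum.
by apply: eq_bigr => i _; rewrite linearZ coefMX.
Qed.

Lemma polyactM p q x : polyact (p * q) x = polyact p (polyact q x).
Proof.
elim/poly_ind: p => [|p c IH]; first by rewrite mul0r !polyact0.
rewrite mulrDl -mulrA ['X * q]mulrC mulrA !polyactD !polyactMX IH polyactC.
by rewrite mul_polyC polyactZ.
Qed.

Lemma polyactXn n x : polyact 'X^n x = iter n A x.
Proof.
elim: n => [|n IH]; first by rewrite expr0 -[1]/(1%:P) polyactC scale1r.
by rewrite exprSr polyactMX IH.
Qed.

Lemma polyact_iter p n x : polyact p (iter n A x) = iter n A (polyact p x).
Proof. by rewrite -!polyactXn -!polyactM mulrC. Qed.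

Lemma polyactr0 p : polyact p 0 = 0.
Proof. by rewrite /polyact big1// => i _; rewrite iter_lfun0 scaler0. Qed.

Lemma Cayley_Hamilton_polyact n : \dim {:H} = n ->
  exists2 chi : {poly F}, chi \is monic & size chi = n.+1 /\
    forall x, polyact chi x = 0.
Proof.
move=> dimH; pose e := vbasis {:H}; have eb : basis_of {:H} e := vbasisP _.
pose M : 'M[F]_(\dim {:H}) := passmx.mxof e e A.
exists (char_poly M); first exact: char_poly_monic.
split=> [|x]; first by rewrite size_char_poly dimH.
apply/eqP; rewrite -(passmx.rVof_eq0 eb); apply/eqP.
(* [horner_mx] requires a matrix of size [m.+1], so the size is generalised; for m = 0 every row
   vector is 0. *)
have key m (B : 'M[F]_m) : m = \dim {:H} -> forall (f : {linear H -> 'rV[F]_m}),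
    (forall y, f (A y) = f y *m B) -> f (polyact (char_poly B) x) = 0.
  case: m B => [|m] B _ f fA; first by apply/rowP => -[].
  have fE p y : f (polyact p y) = f y *m horner_mx B p.
    elim/poly_ind: p => [|p c IH]; first by rewrite polyact0 linear0 rmorph0 mulmx0.
    rewrite polyactD polyactMX polyactC linearD fA IH.
    rewrite linearZ /= rmorphD rmorphM /= horner_mx_X horner_mx_C mulmxDr mulmxA.
    by rewrite mul_mx_scalar.
  by rewrite fE Cayley_Hamilton mulmx0.
pose lin := GRing.isLinear.Build _ _ _ _ (passmx.rVof e) (passmx.rVof_linear e).
pose rV_e := HB.pack (passmx.rVof e) lin : {linear H -> 'rV[F]_(\dim {:H})}.
apply: (key _ M erefl rV_e) => y.
by rewrite /= (passmx.rVof_app e eb).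
Qed.

End PolynomialAction.

(** Split p into linear factors and apply them to x one after another: the last nonzero vector met
    is an eigenvector, and it has the form q(A) x. *)
Lemma annihilated_eigenvector {F : closedFieldType} {H : vectType F} (A : 'End(H))
    (p : {poly F}) (x : H) : p != 0 -> x != 0 -> polyact A p x = 0 ->
  exists q a, polyact A q x != 0 /\ A (polyact A q x) = a *: polyact A q x.
Proof.
move=> p0 x0; have [rs ->] := closed_field_poly_normal p.
rewrite polyactZ => /eqP; rewrite scaler_eq0 lead_coef_eq0 (negPf p0) /= => /eqP.
elim: rs => [|a rs IH].
  by rewrite big_nil -[1]/(1%:P) polyactC scale1r => /eqP; rewrite (negPf x0).
rewrite big_cons polyactM; set q := \prod_(_ <- _) _ => qx.
have [/IH//|qx0] := eqVneq (polyact A q x) 0.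
exists q, a; split => //; apply/eqP; rewrite -subr_eq0 -qx; apply/eqP.
by rewrite polyactB polyactC -['X]mul1r polyactMX -[1]/(1%:P) polyactC scale1r.
Qed.

(** * Contractions with defect index one *)

Section DefectFunctional.
Context {C : numClosedFieldType} {H : vectType C} (dot : {dot H for conjC}).
Variable A : 'End(H).

Lemma dotC x y : dot x y = (dot y x)^*.
Proof. by rewrite (hermC dot) expr0 mul1r. Qed.

Lemma dotDl x y z : dot (x + y) z = dot x z + dot y z.
Proof. exact: linearDl. Qed.

Lemma dotBl x y z : dot (x - y) z = dot x z - dot y z.
Proof. exact: linearBl. Qed.

Lemma dotZl a x z : dot (a *: x) z = a * dot x z.
Proof. exact: linearZl_LR. Qed.

Lemma dotBr x y z : dot z (x - y) = dot z x - dot z y.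
Proof. exact: linearBr. Qed.

Lemma dotZr a x z : dot z (a *: x) = a^* * dot z x.
Proof. exact: linearZr_LR. Qed.

Lemma dot_suml (I : Type) (r : seq I) (E : I -> H) z :
  dot (\sum_(i <- r) E i) z = \sum_(i <- r) dot (E i) z.
Proof. exact: linear_sumlz. Qed.

Lemma dot_sumr (I : Type) (r : seq I) (E : I -> H) z :
  dot z (\sum_(i <- r) E i) = \sum_(i <- r) dot z (E i).
Proof. exact: linear_sumr. Qed.

Lemma contraction_dot : Defs.contraction dot A -> forall x, dot (A x) (A x) <= dot x x.
Proof.
by move=> cA x; have := cA x; rewrite /hnorm ler_sqrtC// nnegrE dnorm_ge0.
Qed.

(** The operator D = 1 - A^* A is positive of rank one. If D u spans its range, the form B x y = <D
    x, y> equals B x u * conj (B y u) / B u u. *)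
Lemma defect_functional : Defs.contraction dot A -> defect_index dot A = 1%N ->
  exists s : {scalar H},
    forall x y, dot x y - dot (A x) (A y) = s x * (s y)^*.
Proof.
move=> cA; rewrite /defect_index; set D := (\1 - _)%VF => dimD.
have DE x y : dot (D x) y = dot x y - dot (A x) (A y).
  rewrite /D add_lfunE opp_lfunE id_lfunE comp_lfunE dotBl; congr (_ - _).
  by rewrite dotC -adjointP -dotC.
have [u Du0] : exists u, D u != 0.
  apply: contrapT => D0; move: dimD; suff -> : D = 0 by rewrite lim0g dimv0.
  apply/lfunP => x; rewrite zero_lfunE; apply/eqP; apply/negPn/negP => Dx.
  by apply: D0; exists x.
have limD : (limg D = <[D u]>)%VS.
  by apply/esym/eqP; rewrite eqEdim -memvE memv_img ?memvf// dimD dim_vline Du0.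
pose B x y := dot x y - dot (A x) (A y).
have BC x y : B x y = (B y x)^* by rewrite /B (dotC x y) (dotC (A x)) rmorphB.
have D_line x : exists k, forall y, B x y = k * B u y.
  have : D x \in (limg D) by rewrite memv_img ?memvf.
  rewrite limD => /vlineP [k Dx]; exists k => y.
  by rewrite /B -!DE Dx dotZl.
(* If B u u were 0, then B x u = 0 for all x since B has rank one, and x = D u would give <D u, D u>
   = 0. *)
have Buu0 : B u u != 0.
  apply: contra_neqN Du0 => /eqP Buu; apply/eqP.
  have Bxu x : B x u = 0 by have [k ->] := D_line x; rewrite Buu mulr0.
  rewrite -(dnorm_eq0 dot) DE -/(B _ _) BC Bxu; apply/eqP; exact: rmorph0.
have Buu_ge0 : 0 <= B u u by rewrite subr_ge0 contraction_dot.
pose r := sqrtC (B u u).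
have r0 : r != 0 by rewrite sqrtC_eq0.
have slin : scalar (fun x => B x u / r).
  by move=> a x y; rewrite /B linearP /= !dotDl !dotZl; ring.
pose slin' := GRing.isLinear.Build _ _ _ _ _ slin.
exists (HB.pack (fun x => B x u / r) slin' : {scalar H}) => /=.
move=> x y; rewrite -/(B x y) rmorphM fmorphV /= -BC.
have -> : r^* = r by apply: conj_Creal; rewrite ger0_real ?sqrtC_ge0.
have [k Bk] := D_line x; rewrite !Bk.
by rewrite mulrACA -invfM -expr2 sqrtCK [RHS]mulrAC mulfK.
Qed.

End DefectFunctional.

(** * Observability and decay of the powers of A *)

Section Observability.
Context {C : numClosedFieldType} {H : vectType C} (dot : {dot H for conjC}).
Variables (A : 'End(H)) (s : {scalar H}) (n : nat).
Hypothesis sE : forall x y, dot x y - dot (A x) (A y) = s x * (s y)^*.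
Hypothesis cnuA : completely_non_unitary A.
Hypothesis dimH : \dim {:H} = n.
Implicit Types (p : {poly C}) (x y : H).

Lemma scalar_polyact m p x : (size p <= m)%N ->
  s (polyact A p x) = \sum_(i < m) p`_i * s (iter i A x).
Proof.
move=> pm; rewrite (polyactE _ _ pm) linear_sum.
by apply: eq_bigr => i _; rewrite linearZ.
Qed.

Lemma sqnorm_defect x : dot x x - dot (A x) (A x) = `|s x| ^+ 2.
Proof. by rewrite sE normCK. Qed.

(* A vector annihilated by all s o A^k spans an invariant subspace on which A is
   isometric, and every eigenvalue of A there is unimodular. *)
Lemma observability x : (forall k, (k < n)%N -> s (iter k A x) = 0) -> x = 0.
Proof.
move=> sx; apply/eqP/negPn/negP => x0.
have [chi chi_monic [size_chi chi0]] := Cayley_Hamilton_polyact A dimH.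
(* Reduction modulo [chi] leaves degree less than n, so the n hypotheses on x reach every p(A) x. *)
have sp p : s (polyact A p x) = 0.
  rewrite [p](Pdiv.IdomainMonic.divp_eq chi_monic) polyactD polyactM chi0 polyactr0 add0r.
  rewrite (@scalar_polyact n); first by rewrite big1// => i _; rewrite sx ?mulr0.
  by rewrite -ltnS -size_chi ltn_modp monic_neq0.
have [q [a []]] := annihilated_eigenvector (monic_neq0 chi_monic) x0 (chi0 x).
set y := polyact A q x => y0 Ay.
have : dot y y - dot (A y) (A y) = 0 by rewrite sqnorm_defect sp normr0 expr0n.
move/eqP; rewrite Ay dotZl dotZr mulrA -normCK -[X in X - _]mul1r -mulrBl.
rewrite mulf_eq0 dnorm_eq0 (negPf y0) orbF subr_eq0 eq_sym sqrp_eq1//.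
apply/negP/cnuA; rewrite /passmx.leigenvalue; apply: contraNneq y0 => ker0.
rewrite -memv0 -ker0 memv_ker add_lfunE opp_lfunE scale_lfunE id_lfunE.
by rewrite Ay subrr.
Qed.

Lemma defect_telescope m x :
  \sum_(j < m) `|s (iter j A x)| ^+ 2 = dot x x - dot (iter m A x) (iter m A x).
Proof.
elim: m => [|m IH]; first by rewrite big_ord0 subrr.
by rewrite big_ord_recr /= IH -sqnorm_defect addrA subrK.
Qed.

Lemma dot_iter_le k m x : (k <= m)%N ->
  dot (iter m A x) (iter m A x) <= dot (iter k A x) (iter k A x).
Proof.
move=> km; rewrite -(subnK km) iterD -subr_ge0 -defect_telescope.
by apply: sumr_ge0 => i _; rewrite exprn_ge0.
Qed.

(** By observability the n functionals s o A^j separate points, so they form a basis of the dual of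
    H; [b] is the dual basis. *)
Lemma observability_inverse : exists b : 'I_n -> H,
  (forall x, x = \sum_(j < n) s (iter j A x) *: b j) /\
  (forall i k : 'I_n, s (iter k A (b i)) = (k == i)%:R).
Proof.
pose obs x : 'rV[C]_n := \row_(j < n) s (iter j A x).
have lin : linear obs.
  by move=> a x y; apply/rowP => j; rewrite !mxE iter_linear linearP.
pose lin' := GRing.isLinear.Build _ _ _ _ obs lin.
pose f := linfun (HB.pack obs lin' : {linear H -> 'rV[C]_n}).
have fE x : f x = obs x by rewrite lfunE.
have f0 : lker f == 0%VS.
  apply/lker0P => u v uv; apply/eqP; rewrite -subr_eq0; apply/eqP/observability => k kn.
  have := congr1 (fun r : 'rV[C]_n => r 0 (Ordinal kn)) uv; rewrite !fE !mxE /= => suv.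
  by rewrite -[u]scale1r addrC -scaleN1r scale1r iter_linear linearP /= suv mulN1r addNr.
have fT : limg f = fullv.
  apply/eqP; rewrite eqEdim subvf limg_dim_eq ?(eqP f0) ?capv0//.
  by rewrite dimvf dimH /dim /= mul1n.
exists (fun j => (f^-1)%VF (delta_mx 0 j)); split => [x|i k].
  rewrite -[LHS](lker0_lfunK f0) fE [obs x]row_sum_delta linear_sum.
  by apply: eq_bigr => j _; rewrite linearZ /= mxE.
have := limg_lfunVK (_ : delta_mx 0 i \in limg f); rewrite fT memvf => /(_ isT).
by rewrite fE => /(congr1 (fun r : 'rV[C]_n => r 0 k)); rewrite !mxE eqxx => ->.
Qed.

(** In the dual basis <x, x> is a sum of products of coordinates s (A^j x), each at most the sum of
    their squared moduli, which telescopes. Thus n steps of A lose a fixed fraction of the squared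
    norm. *)
Lemma observability_bound : exists2 K : C, 0 <= K &
  forall x, dot x x <= K * (dot x x - dot (iter n A x) (iter n A x)).
Proof.
have [b [xb _]] := observability_inverse.
pose K := \sum_(i < n) \sum_(j < n) `|dot (b i) (b j)|.
exists K => [|x]; first by do 2 (apply: sumr_ge0 => ? _).
rewrite -defect_telescope; set Y := \sum_(j < n) _.
have sY (j : 'I_n) : `|s (iter j A x)| ^+ 2 <= Y.
  by rewrite /Y (bigD1 j)//= lerDl sumr_ge0// => i _; rewrite exprn_ge0.
have ssY (i j : 'I_n) : `|s (iter i A x)| * `|s (iter j A x)| <= Y.
  have [u0 w0] : 0 <= `|s (iter i A x)| /\ 0 <= `|s (iter j A x)| by [].
  have /orP[uw|uw] := real_leVge (ger0_real u0) (ger0_real w0).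
    by apply: le_trans (sY j); rewrite expr2 ler_wpM2r.
  by apply: le_trans (sY i); rewrite expr2 ler_wpM2l.
rewrite -[leLHS]ger0_norm ?dnorm_ge0// {1}[x]xb dot_suml mulr_suml.
apply: le_trans (ler_norm_sum _ _ _) _; apply: ler_sum => i _.
rewrite dotZl {2}[x]xb dot_sumr mulr_sumr mulr_suml.
apply: le_trans (ler_norm_sum _ _ _) _; apply: ler_sum => j _.
by rewrite dotZr mulrA !normrM norm_conjC mulrC ler_wpM2l.
Qed.

Lemma dot_iter_decay : exists2 K : C, 0 <= K & forall m x,
  m%:R * dot (iter (m * n) A x) (iter (m * n) A x) <= K * dot x x.
Proof.
have [K K0 Kx] := observability_bound; exists K => // m x.
apply: (@le_trans _ _ (K * (dot x x - dot (iter (m * n) A x) (iter (m * n) A x)))).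
  (* dot (A^k x) (A^k x) decreases with k, so its m values at the multiples of n are
     all at least the last one, and the bounds for them telescope. *)
  elim: m => [|m IH]; first by rewrite mul0r subrr mulr0.
  have := Kx (iter (m * n) A x); rewrite -iterD -mulSn.
  have := @dot_iter_le (m * n) (m.+1 * n) x; rewrite leq_mul2r leqnSn orbT => /(_ isT).
  set u := dot (iter (m * n) A x) _ in IH *; set w := dot (iter (m.+1 * n) A x) _.
  move=> wu uK; rewrite -natr1 mulrDl mul1r.
  have -> : K * (dot x x - w) = K * (dot x x - u) + K * (u - w) by ring.
  apply: lerD (le_trans wu uK); apply: le_trans IH.
  by rewrite ler_wpM2l.
by rewrite ler_wpM2l// gerBl dnorm_ge0.
Qed.

End Observability.

(** * Positivity of the truncated density *)

Lemma complex_archi_bound {R : realType} (x : R[i]) : 0 <= x ->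
  exists m : nat, x <= m%:R.
Proof.
case: x => a b; rewrite lecE /= => /andP[/eqP -> a0].
exists (truncn a).+1; rewrite -(rmorph_nat (@real_complex R)) lecE /= eqxx /=.
by rewrite ltW// truncnS_gt.
Qed.

(** Horner's scheme: if q is the quotient for p, then p + z q is the one for p X + c. The bound B is
    uniform in z because |z| = 1. *)
Lemma divided_difference {C : numDomainType} (p : {poly C}) :
  exists2 B : C, 0 <= B & forall z, `|z| = 1 -> `|p.[z]| <= B /\
    exists2 q, p - p.[z]%:P = ('X - z%:P) * q & forall i, `|q`_i| <= B.
Proof.
elim/poly_ind: p => [|p c [B B0 IH]].
  exists 0 => // z _; rewrite horner0 normr0; split=> //.
  by exists 0; [rewrite subrr mulr0 | move=> i; rewrite coef0 normr0].
pose S := \sum_(i < size p) `|p`_i|.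
have S0 : 0 <= S by apply: sumr_ge0.
exists (B + S + `|c|) => [|z z1]; first by rewrite !addr_ge0.
have [pz [q pq qB]] := IH z z1; split.
  rewrite hornerMXaddC (le_trans (ler_normD _ _))// lerD2r normrM z1 mulr1.
  by rewrite (le_trans pz)// lerDl.
exists (p + z *: q) => [|i].
  rewrite hornerMXaddC polyCD polyCM mulrDr -scalerAr -pq.
  by rewrite -mul_polyC mulrBl; ring.
rewrite coefD coefZ (le_trans (ler_normD _ _))// normrM z1 mul1r.
have [si|si] := ltnP i (size p).
  have : `|p`_i| <= S by rewrite /S (bigD1 (Ordinal si))//= lerDl sumr_ge0.
  by move=> /lerD /(_ (qB i)) /le_trans -> //; rewrite addrC lerDl.
by rewrite nth_default// normr0 add0r (le_trans (qB i))// -addrA lerDl addr_ge0.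
Qed.

Lemma addcJ_le {C : numClosedFieldType} (e : C) : e + e^* <= `|e| *+ 2.
Proof.
apply: le_trans (real_ler_norm _) _; last first.
  by rewrite (le_trans (ler_normD _ _))// norm_conjC mulr2n.
by apply/CrealP; rewrite rmorphD /= conjCK addrC.
Qed.

Section Positivity.
Context {R : realType} {H : vectType R[i]} (dot : {dot H for (@conjC R[i])}).
Variables (A : 'End(H)) (s : {scalar H}) (n : nat).
Hypothesis sE : forall x y, dot x y - dot (A x) (A y) = s x * (s y)^*.
Hypothesis cnuA : completely_non_unitary A.
Hypothesis dimH : \dim {:H} = n.+1.

(** Normalise the last vector of the dual basis of the functionals s o A^j, j <= n. *)
Lemma last_observed_unit_vector : exists v, [/\ dot v v = 1,
  forall k, (k < n)%N -> s (iter k A v) = 0 & s (iter n A v) != 0].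
Proof.
have [b [_ sb]] := observability_inverse sE cnuA dimH; pose w := b ord_max.
have sw k : (k < n.+1)%N -> s (iter k A w) = (k == n)%:R.
  by move=> kn; rewrite (sb ord_max (Ordinal kn)).
have w0 : w != 0.
  apply: contraTneq (oner_neq0 R[i]) => w0; rewrite negbK.
  by have := sw n (leqnn _); rewrite w0 iter_lfun0 linear0 eqxx => ->.
have dw : dot w w != 0 by rewrite dnorm_eq0.
pose r := sqrtC (dot w w); have r0 : r != 0 by rewrite sqrtC_eq0.
have sv k : s (iter k A (r^-1 *: w)) = r^-1 * s (iter k A w).
  by rewrite -[_ *: w]addr0 iter_linear iter_lfun0 addr0 linearZ.
exists (r^-1 *: w); split=> [|k kn|].
- rewrite dotZl dotZr fmorphV /=.
  have -> : r^* = r by apply: conj_Creal; rewrite ger0_real ?sqrtC_ge0 ?dnorm_ge0.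
  by rewrite mulrA -invfM -expr2 sqrtCK mulVf.
- by rewrite sv sw ?ltnS ?(ltnW kn)// ltn_eqF ?mulr0.
- by rewrite sv sw// eqxx mulr1 invr_eq0.
Qed.

Variable v : H.
Hypothesis v1 : dot v v = 1.
Hypothesis sv0 : forall k, (k < n)%N -> s (iter k A v) = 0.
Hypothesis sv_neq0 : s (iter n A v) != 0.

Definition moment k := dot (iter k A v) v.

(** By Cauchy-Schwarz |c_k|^2 is at most <A^k v, A^k v>, which tends to 0. *)
Lemma moment_vanishes d : 0 < d -> exists N, forall k, (N <= k)%N -> `|moment k| <= d.
Proof.
move=> d0; have [K K0 Kv] := dot_iter_decay sE cnuA dimH.
have [m Km] : exists m : nat, K / d ^+ 2 <= m%:R.
  by apply: complex_archi_bound; rewrite divr_ge0// exprn_ge0// ltW.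
exists (m.+1 * n.+1)%N => k Nk; rewrite -(@ler_pXn2r _ 2%N)// ?nnegrE// ?(ltW d0)//.
have /le_trans -> // : `|moment k| ^+ 2 <= dot (iter k A v) (iter k A v).
  by have [+ _] := CauchySchwarz dot (iter k A v) v; rewrite v1 mulr1.
have /le_trans -> // := dot_iter_le sE v Nk.
rewrite -(@ler_pM2l _ m.+1%:R)// ?ltr0Sn//.
have /le_trans -> // := Kv m.+1 v; rewrite v1 mulr1.
rewrite -ler_pdivrMr ?exprn_gt0//; apply: (le_trans Km).
by rewrite ler_nat.
Qed.

(* With c_0 = 1 and c_(-k) = conj c_k, the real number G + conj G - 1, for
   G = herglotz_sum N z, is the sum of c_k (conj z)^k over |k| < N. *)
Definition herglotz_sum N (z : R[i]) := \sum_(k < N) z^* ^+ k * moment k.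

(** Multiplied by |chi(z)|^2, the expression becomes [k2] - 2 Re E, where [k2] does not depend on z
    and E is small uniformly in z for large N. *)
Lemma herglotz_sum_gt0 M : exists2 N, (M <= N)%N & forall z : R[i], `|z| = 1 ->
  0 < herglotz_sum N z + (herglotz_sum N z)^* - 1.
Proof.
have [chi chi_monic [size_chi chi0]] := Cayley_Hamilton_polyact A dimH.
have [B B0 chiB] := divided_difference chi.
pose k2 := `|s (iter n A v)| ^+ 2.
have k20 : 0 < k2 by rewrite exprn_gt0// normr_gt0.
(* |E| is at most B * B (n + 1) times a bound for the moments of index at least N; with the bound
   [k2 / D] this gives 2 |E| < [k2]. *)
pose D := B * (B *+ n.+1) *+ 2 + 1.
have D0 : 0 < D by rewrite ltr_wpDl// mulrn_wge0// mulr_ge0// mulrn_wge0.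
have [N0 NcN] := moment_vanishes (divr_gt0 k20 D0).
exists (M + N0)%N => [|z z1]; first exact: leq_addr.
set N := (M + N0)%N; have {}NcN k : (N <= k)%N -> `|moment k| <= k2 / D.
  by move=> Nk; apply/NcN/(leq_trans _ Nk)/leq_addl.
have [chiz [P chiP PB]] := chiB z z1.
have zz : z * z^* = 1 by rewrite -normCK z1 expr1n.
have sizeP : (size P <= n.+1)%N.
  have [->|P0] := eqVneq P 0; first by rewrite size_poly0.
  have : (size (('X - z%:P) * P)%R <= n.+2)%N.
    rewrite -chiP (leq_trans (size_polyD _ _))// size_polyN geq_max size_chi leqnn.
    exact: leq_trans (size_polyC_leq1 _) _.
  by rewrite size_monicM ?monicXsubC// size_XsubC.
have leadP : P`_n = 1.
  have := congr1 (fun p : {poly R[i]} => p`_n.+1) chiP.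
  rewrite coefB coefC subr0 mulrBl coefB mulrC coefMX coefCM /=.
  rewrite (nth_default _ sizeP) mulr0 subr0 => <-.
  by move: chi_monic; rewrite monicE lead_coefE size_chi => /eqP.
(* p is chi(z) times (1 - conj z A)^-1 v, written without dividing by chi(z), and E is
   the error made by truncating the series of the resolvent. *)
pose p := z *: polyact A P v; pose Q := chi.[z]; pose u := Q *: v.
(* P is monic of degree n and s kills A^k v for k < n, so only the top term survives. *)
have sp : `|s p| ^+ 2 = k2.
  rewrite linearZ /= (scalar_polyact A s _ sizeP) big_ord_recr big1 /= => [|i _].
    by rewrite add0r leadP mul1r normrM z1 mul1r.
  by rewrite sv0 ?mulr0.
(* Evaluate chi - chi(z) = (X - z) P at A on v, where chi(A) v = 0, and use z * conj z = 1. *)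
have uE : u = p - z^* *: A p.
  rewrite /p [A _]linearZ /= scalerA mulrC zz scale1r -polyactMX.
  have := congr1 (polyact A ^~ v) chiP.
  rewrite mulrBl -['X * P]mulrC !polyactB polyactMX polyactC chi0 sub0r.
  by rewrite mul_polyC polyactZ => /(congr1 -%R); rewrite opprK opprB.
pose E := z^* ^+ N * dot (iter N A p) u.
have EB : `|E| *+ 2 < k2.
  have -> : `|E| = `|Q| * `|dot (iter N A (polyact A P v)) v|.
    rewrite /E normrM normrX norm_conjC z1 expr1n mul1r /p /u.
    rewrite -[z *: _]addr0 iter_linear iter_lfun0 addr0 dotZl dotZr.
    by rewrite !normrM norm_conjC z1 mul1r.
  have : `|dot (iter N A (polyact A P v)) v| <= B *+ n.+1 * (k2 / D).
    rewrite -polyact_iter (polyactE _ _ sizeP) dot_suml.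
    apply: le_trans (ler_norm_sum _ _ _) _.
    rewrite -[n.+1 in leRHS]card_ord -sumr_const mulr_suml ler_sum// => i _.
    rewrite dotZl normrM ler_pM// -iterD; apply: NcN; exact: leq_addl.
  move=> /(ler_pM (normr_ge0 _) (normr_ge0 _) chiz) E2.
  rewrite -mulr_natr (le_lt_trans (ler_wpM2r _ E2))//.
  have kD : k2 = k2 / D * D by rewrite divfK ?gt_eqF.
  have e0 : 0 < k2 / D by rewrite divr_gt0.
  rewrite [ltRHS]kD -subr_gt0; move: (k2 / D) e0 => e e0.
  by rewrite (_ : _ - _ = e) // /D; ring.
(* Geometric sum: the powers (conj z A)^k, k < N, applied to u = (1 - conj z A) p add up to p -
   (conj z A)^N p. *)
have QG : `|Q| ^+ 2 * herglotz_sum N z = dot p u - E.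
  have -> : `|Q| ^+ 2 * herglotz_sum N z = dot (\sum_(k < N) z^* ^+ k *: iter k A u) u.
    rewrite dot_suml mulr_sumr; apply: eq_bigr => k _.
    rewrite /u -[Q *: v]addr0 iter_linear iter_lfun0 !addr0 !dotZl dotZr normCK /moment.
    by ring.
  rewrite /E -dotZl -dotBl; congr (dot _ _).
  elim: N {NcN EB} @E => [|N IH]; first by rewrite big_ord0 scale1r subrr.
  rewrite big_ord_recr /= IH uE.
  have -> : p - z^* *: A p = - z^* *: A p + p by rewrite addrC scaleNr.
  rewrite iter_linear scalerDr scalerA mulrN -exprSr scaleNr -iterSr.
  by rewrite [X in _ + X = _]addrC addrA addrNK.
(* The main term is 2 Re <p, u> - <u, u> = <p, p> - <p - u, p - u> = <p, p> - <A p, A p> = |s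
   p|^2. *)
have g_eq : `|Q| ^+ 2 * (herglotz_sum N z + (herglotz_sum N z)^* - 1) = k2 - (E + E^*).
  rewrite mulrBr mulrDr mulr1.
  have -> : `|Q| ^+ 2 * (herglotz_sum N z)^* = (dot p u - E)^*.
    rewrite -QG [RHS]rmorphM; congr (_ * _).
    by apply/esym/conj_Creal; rewrite realX ?normr_real.
  have -> : (dot p u - E)^* = dot u p - E^* by rewrite (dotC dot u p); exact: rmorphB.
  rewrite QG -sp -(sqnorm_defect sE).
  have -> : `|Q| ^+ 2 = dot u u by rewrite dotZl dotZr v1 mulr1 normCK.
  have -> : dot (A p) (A p) = dot (p - u) (p - u).
    by rewrite uE opprB addrC subrK dotZl dotZr conjCK mulrA [z^* * z]mulrC zz mul1r.
  by rewrite dotBl !dotBr; ring.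
have : 0 < `|Q| ^+ 2 * (herglotz_sum N z + (herglotz_sum N z)^* - 1).
  by rewrite g_eq subr_gt0 (le_lt_trans (addcJ_le E)).
(* A zero of chi at z would contradict the strict inequality just obtained. *)
have [->|Q0] := eqVneq Q 0; first by rewrite normr0 expr0n mul0r ltxx.
by rewrite pmulr_rgt0// exprn_gt0// normr_gt0.
Qed.

End Positivity.

(** * Trigonometric moments of atomic measures *)

(** Take for [mu] the sum over j of 2^-(j+1) times the measure with masses [w j l] at [x j l]. These
    coefficients sum to 1, so an integral common to all these measures is kept. *)
Lemma atomic_mixture d (T : measurableType d) (R : realType)
    (m : nat -> nat) (w : nat -> nat -> R) (x : nat -> nat -> T) :
    (forall j l, 0 <= w j l) -> (forall j, \sum_(l < m j) w j l = 1) ->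
  exists mu : probability T R,
    (forall j l B, (l < m j)%N -> 0 < w j l -> B (x j l) -> mu B != 0%E) /\
    forall (f : T -> R) K a, measurable_fun setT f -> (forall t, `|f t| <= K) ->
      (forall j, \sum_(l < m j) w j l * f (x j l) = a) ->
      \int[mu]_(t in setT) f t = a.
Proof.
move=> w0 w1.
have q0 j l : 0 <= w j l / 2 ^+ j.+1 by rewrite divr_ge0// exprn_ge0.
pose nu_ j := msum (fun l => mscale (NngNum (q0 j l)) \d_(x j l)) (m j).
pose nu := mseries nu_ 0.
have nuE (f : T -> R) a : measurable_fun setT f -> (forall t, 0 <= f t) ->
    (forall j, \sum_(l < m j) w j l * f (x j l) = a) ->
    (\int[nu]_(t in setT) (f t)%:E = a%:E)%E.
  move=> mf f0 wf; have /measurable_EFinP mEf := mf.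
  have Ef0 t : (0 <= (f t)%:E)%E by rewrite lee_fin.
  rewrite ge0_integral_measure_series//.
  rewrite (@eq_eseriesr _ _ (fun j => (a / (2 ^ (j + 1))%:R)%:E)); last first.
    move=> j _; rewrite ge0_integral_measure_sum//.
    rewrite -(wf j) mulr_suml -sumEFin; apply: eq_bigr => l _.
    rewrite ge0_integral_mscale// integral_dirac// diracT mul1e -EFinM /=.
    by rewrite natrX addn1 mulrAC.
  have /cvg_lim := @cvg_geometric_eseries_half R a 0.
  by rewrite expr0 divr1; apply.
have nuT : nu setT = 1%E.
  have : (\int[nu]_(t in setT) (cst 1%:E t) = 1%:E)%E.
    apply: (nuE (cst 1)) => [|t|j]; [exact: measurable_cst|exact: ler01|].
    by rewrite -[RHS](w1 j); apply: eq_bigr => l _; exact: mulr1.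
  by rewrite integral_cst// mul1e.
have [P PE] : exists P : probability T R, P = nu :> (set T -> \bar R).
  by exists (HB.pack nu (@Measure_isProbability.Build _ _ _ nu nuT) : probability T R).
have PI (g : T -> R) : (\int[P]_(t in setT) (g t)%:E = \int[nu]_(t in setT) (g t)%:E)%E.
  by rewrite -PE.
exists P; split => [j l B lm wjl Bx|f K a mf fK wf].
  suff : (0 < nu B)%E by rewrite PE lt0e => /andP[].
  apply: (@lt_le_trans _ _ (w j l / 2 ^+ j.+1)%:E).
    by rewrite lte_fin divr_gt0// exprn_gt0.
  apply: le_trans (@nneseries_lim_ge R (fun i => nu_ i B) xpredT 0 j.+1 _); last first.
    by move=> i _ _; exact: (measure_ge0 (nu_ i)).
  rewrite big_nat_recr//= {2}/nu_ /msum (bigD1 (Ordinal lm))//= {1}/mscale /=.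
  rewrite diracE mem_set// mule1 addeCA leeDl// adde_ge0//; apply: sume_ge0 => i _.
    exact: (measure_ge0 (nu_ i)).
  exact: (measure_ge0 (mscale (NngNum (q0 j i)) \d_(x j i))).
have K0 : 0 <= K by apply: le_trans (fK point).
have bounded_integrable (g : T -> R) M : measurable_fun setT g ->
    (forall t, `|g t| <= M) -> P.-integrable setT (EFin \o g).
  move=> mg gM; apply: measurable_bounded_integrable => //.
    by rewrite [X in (X < _)%E]probability_setT ltry.
  exists M; split; first exact: num_real.
  by move=> M' MM' t _ /=; apply: le_trans (gM t) (ltW MM').
(* Shifting by K makes the integrand nonnegative, as [nuE] demands. *)
have -> : \int[P]_(t in setT) f t = \int[P]_(t in setT) ((f t + K) - K).
  by apply: eq_Rintegral => t _; rewrite addrK.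
rewrite RintegralB//; first last.
- by apply: (bounded_integrable (cst K) K) => // t; rewrite /cst ger0_norm.
- apply: (bounded_integrable (fun t => f t + K) (K + K)) => [|t].
    exact: measurable_funD.
  by rewrite (le_trans (ler_normD _ _))// lerD// ger0_norm.
rewrite Rintegral_cst// [X in fine X]probability_setT /= mulr1.
rewrite /Rintegral PI (nuE (fun t => f t + K) (a + K)) /= ?addrK//.
- exact: measurable_funD.
- by move=> t; rewrite -lerBlDr sub0r; have := fK t; rewrite ler_norml => /andP[].
- move=> j; under eq_bigr do rewrite mulrDr.
  by rewrite big_split /= wf -mulr_suml w1 mul1r.
Qed.

(** In characteristic 0, X^n - 1 is separable, so it has n distinct roots, and one of them is
    primitive. *)
Lemma prim_root_exists (C : numClosedFieldType) n :
  (0 < n)%N -> exists z : C, n.-primitive_root z.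
Proof.
move=> n0; have [r] := closed_field_poly_normal ('X^n - 1 : {poly C}).
rewrite (monicP (monicXnsubC 1 n0)) scale1r => rE.
suff /hasP[z _ zn] : has n.-primitive_root r by exists z.
apply: has_prim_root => //.
- by apply/allP => z zr; rewrite /root_of_unity rE root_prod_XsubC.
- by rewrite -separable_prod_XsubC -rE separable_Xn_sub_1// pnatr_eq0 -lt0n.
- by rewrite -ltnS -(size_prod_XsubC r id) -rE size_XnsubC.
Qed.

(** If m does not divide k, then w^k <> 1 but (w^k)^m = 1, so the geometric sum vanishes. *)
Lemma sum_prim_root_exp (F : fieldType) (m k : nat) (w : F) :
  m.-primitive_root w -> \sum_(l < m) (w ^+ l) ^+ k = (m %| k)%N%:R * m%:R.
Proof.
move=> wm; have [mk|mk] := boolP (m %| k)%N.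
  rewrite mul1r -[X in _ = X%:R]card_ord -sumr_const; apply: eq_bigr => l _.
  by rewrite -exprM mulnC exprM -(prim_expr_mod wm k) (eqP mk) expr1n.
rewrite mul0r; have wk1 : w ^+ k - 1 != 0.
  by rewrite subr_eq0 -(prim_order_dvd wm).
have := subrX1 (w ^+ k) m.
rewrite -exprM mulnC exprM (prim_expr_order wm) expr1n subrr => /esym/eqP.
rewrite mulf_eq0 (negPf wk1) /= => /eqP S0; rewrite -[RHS]S0.
by apply: eq_bigr => l _; rewrite -!exprM mulnC.
Qed.

Lemma normr_prim_root (C : numDomainType) m (w : C) :
  (0 < m)%N -> m.-primitive_root w -> `|w| = 1.
Proof.
move=> m0 wm; have /eqP := congr1 Num.norm (prim_expr_order wm).
by rewrite normrX normr1 pexpr_eq1 ?normr_ge0// => /eqP.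
Qed.

Section RootsOfUnityQuadrature.
Context {C : numClosedFieldType} (c : nat -> C) (N m : nat) (w : C).
Hypothesis c0 : c 0 = 1.
Hypothesis N0 : (0 < N)%N.
Hypothesis Nm : (N + N <= m)%N.
Hypothesis wm : m.-primitive_root w.

Let G (z : C) := \sum_(k < N) z^* ^+ k * c k.

(* The frequencies k - i and k + i with i < N have absolute value less than m, so there
   is no aliasing: m divides them only when they vanish. *)
Lemma prim_root_quadrature k : (k < N)%N ->
  \sum_(l < m) (G (w ^+ l) + (G (w ^+ l))^* - 1) / m%:R * (w ^+ l) ^+ k = c k.
Proof.
move=> kN; have m0 : (0 < m)%N by lia.
have mC : m%:R != 0 :> C by rewrite pnatr_eq0; lia.
have w1 l : `|w ^+ l| = 1 by rewrite normrX (normr_prim_root m0 wm) expr1n.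
(* Conjugation inverts m-th roots of unity; the exponent m - i keeps the powers natural. *)
have conjE l i : (i <= m)%N -> (w ^+ l)^* ^+ i = (w ^+ l) ^+ (m - i).
  move=> im; apply: (@mulIf _ ((w ^+ l) ^+ i)).
    by rewrite expf_neq0// -normr_gt0 w1.
  rewrite -exprD subnK// -exprMn mulrC -normCK w1 !expr1n.
  by rewrite -exprM mulnC exprM (prim_expr_order wm) expr1n.
have sumG : \sum_(l < m) G (w ^+ l) * (w ^+ l) ^+ k = c k * m%:R.
  under eq_bigr do rewrite mulr_suml.
  rewrite exchange_big /= (bigD1 (Ordinal kN))//= [X in _ + X]big1 ?addr0 => [|i ik].
    under eq_bigr => l _.
      rewrite mulrAC conjE; last lia.
      rewrite -exprD subnK; last lia.
    over.
    by rewrite -mulr_suml sum_prim_root_exp// dvdnn mul1r mulrC.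
  under eq_bigr => l _.
    rewrite mulrAC conjE; last by have := ltn_ord i; lia.
    rewrite -exprD.
  over.
  rewrite -mulr_suml sum_prim_root_exp// (_ : (m %| _)%N = false) ?mul0r//.
  apply/negP => /dvdnP [q qE].
  have iN := ltn_ord i; have qm : (q * m = m - i + k)%N by [].
  have q1 : q = 1%N by nia.
  by move/eqP: ik; apply; apply: val_inj => /=; rewrite q1 in qm; lia.
(* Only i = 0 with k = 0 contributes; the term -1 of the density cancels this contribution below. *)
have sumGc : \sum_(l < m) (G (w ^+ l))^* * (w ^+ l) ^+ k = (k == 0%N)%:R * m%:R.
  have GJ l : (G (w ^+ l))^* = \sum_(i < N) (w ^+ l) ^+ i * (c i)^*.
    rewrite rmorph_sum; apply: eq_bigr => i _.
    by rewrite rmorphM rmorphXn /= conjCK.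
  under eq_bigr do rewrite GJ mulr_suml.
  rewrite exchange_big /= (bigD1 (Ordinal N0))//= [X in _ + X]big1 ?addr0 => [|i i0].
    under eq_bigr => l _ do rewrite c0 rmorph1 mulr1 expr0 mul1r.
    rewrite sum_prim_root_exp//; congr (_%:R * _).
    by case: k kN {sumG} => [|k] kN; rewrite ?dvdn0// gtnNdvd//; lia.
  under eq_bigr do rewrite mulrAC -exprD.
  rewrite -mulr_suml sum_prim_root_exp// gtnNdvd ?mul0r//.
    by rewrite addn_gt0 lt0n; apply/orP; left.
  by have := ltn_ord i; lia.
transitivity ((\sum_(l < m) G (w ^+ l) * (w ^+ l) ^+ k +
    \sum_(l < m) (G (w ^+ l))^* * (w ^+ l) ^+ k - \sum_(l < m) (w ^+ l) ^+ k) / m%:R).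
  rewrite -big_split -sumrB mulr_suml; apply: eq_bigr => l _ /=.
  by rewrite mulrAC; congr (_ / _); rewrite mulrBl mulrDl mul1r.
rewrite sumG sumGc sum_prim_root_exp// (_ : (m %| k)%N = (k == 0%N)).
  by rewrite -addrA subrr addr0 mulfK.
by case: k kN {sumG sumGc} => [|k] kN; rewrite ?dvdn0// gtnNdvd//; lia.
Qed.

End RootsOfUnityQuadrature.

Lemma Re_Im_norm_le {R : realType} (w : R[i]) (K : R) : `|w| <= K%:C ->
  `|complex.Re w| <= K /\ `|complex.Im w| <= K.
Proof.
move=> wK; have K0 : 0 <= K by rewrite -lecR; exact: le_trans (normr_ge0 w) wK.
have : sqnorm w <= K ^+ 2.
  by rewrite -lecR sqnormE rmorphXn /= lerXn2r// nnegrE ?lecR.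
rewrite /sqnorm => h; split; rewrite -ler_sqr ?nnegrE// real_normK ?num_real//.
  by apply: le_trans h; rewrite lerDl sqr_ge0.
by apply: le_trans h; rewrite lerDr sqr_ge0.
Qed.

Lemma Cmeasurable_exp {R : realType} k :
  Cmeasurable (fun z : circle R => (z : R[i]) ^+ k).
Proof.
rewrite (_ : (fun z => _) = (fun z : circle R => ('X^k : {poly R[i]}).[z : R[i]])).
  exact: Cmeasurable_horner.
by apply/funext => z; rewrite hornerXn.
Qed.

Lemma herglotz_moment_measure {R : realType} (c : nat -> R[i]) (N : nat) :
    c 0%N = 1 -> (0 < N)%N ->
    (forall z : R[i], `|z| = 1 ->
      0 < \sum_(k < N) z^* ^+ k * c k + (\sum_(k < N) z^* ^+ k * c k)^* - 1) ->
  exists2 mu : probability (circle R) R, nontrivial mu &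
    forall k, (k < N)%N -> Cintegral mu (fun z => (z : R[i]) ^+ k) = c k.
Proof.
(* The quadrature is exact from N + N nodes on; adding j makes the number of atoms unbounded. *)
move=> c0 N0 gt0; pose m j := (N + N + j)%N.
have m0 j : (0 < m j)%N by rewrite /m; lia.
have [w wm] := choice (fun j => prim_root_exists R[i] (m0 j)).
have w1 j l : `|w j ^+ l| = 1 by rewrite normrX (normr_prim_root (m0 j) (wm j)) expr1n.
(* The default point 1 is never taken, as w j ^+ l has modulus 1. *)
pose x j l : circle R := insubd (Circle (norm1_circle (R := R))) (w j ^+ l).
have xE j l : x j l = w j ^+ l :> R[i] by rewrite /x insubdK// unfold_in w1.
pose G (z : R[i]) := \sum_(k < N) z^* ^+ k * c k.
pose g (z : R[i]) := G z + (G z)^* - 1.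
pose r j l := complex.Re (g (w j ^+ l) / (m j)%:R).
have r_gt0C j l : 0 < g (w j ^+ l) / (m j)%:R by rewrite divr_gt0 ?gt0// ltr0n.
have rE j l : (r j l)%:C = g (w j ^+ l) / (m j)%:R.
  exact/RRe_real/gtr0_real.
have r_gt0 j l : 0 < r j l by rewrite -ltcR rE.
have moments j k : (k < N)%N -> \sum_(l < m j) (r j l)%:C * (w j ^+ l) ^+ k = c k.
  move=> kN; rewrite -(prim_root_quadrature c0 N0 _ (wm j) kN); last by rewrite /m; lia.
  by apply: eq_bigr => l _; rewrite rE.
have r1 j : \sum_(l < m j) r j l = 1.
  apply: (@complexI R); rewrite rmorph_sum rmorph1 -c0 -(moments j 0%N N0) /=.
  by apply: eq_bigr => l _; rewrite expr0 mulr1.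
have [mu [mu_atom mu_int]] :=
  @atomic_mixture _ (circle R) R m r x (fun j l => ltW (r_gt0 j l)) r1.
exists mu => [[F /finite_seqP [s Fs] muF]|k kN].
  (* A set of full measure contains every atom, and this j supplies N + N + j distinct ones, more
     than F can hold. *)
  pose j := size s; have xF l : (l < m j)%N -> x j l \in s.
    move=> lm; apply: contrapT => xs.
    suff Fx : (~` F)%classic (x j l).
      by have := mu_atom j l _ lm (r_gt0 j l) Fx; rewrite muF eqxx.
    by rewrite Fs.
  have : (m j <= size s)%N.
    rewrite -[m j](size_iota 0) -(size_map (x j)); apply: uniq_leq_size.
      rewrite map_inj_in_uniq ?iota_uniq// => a b; rewrite !mem_iota !add0n => am bm.
      move=> /(congr1 (@circle_val R)); rewrite !xE => /eqP.
      by rewrite (eq_prim_root_expr (wm j)) !modn_small// => /eqP.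
    by move=> _ /mapP [l + ->]; rewrite mem_iota => /andP[_ lm]; exact: xF.
  by rewrite /m /j; lia.
have [mr mi] := @Cmeasurable_exp R k.
have z1 (z : circle R) : `|(z : R[i]) ^+ k| <= (1 : R)%:C.
  by rewrite normrX norm_circle expr1n.
apply/eqP; rewrite /Cintegral eq_complex /=; apply/andP; split; apply/eqP.
  apply: (mu_int _ 1) => // [z|j]; first by have [] := Re_Im_norm_le (z1 z).
  rewrite -(moments j k kN) raddf_sum; apply: eq_bigr => l _.
  by rewrite xE; case: (_ ^+ k) => u v /=; rewrite mul0r subr0.
apply: (mu_int _ 1) => // [z|j]; first by have [] := Re_Im_norm_le (z1 z).
rewrite -(moments j k kN) raddf_sum; apply: eq_bigr => l _.
by rewrite xE; case: (_ ^+ k) => u v /=; rewrite mul0r addr0.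
Qed.

(** * Integrals of polynomials on the circle *)

Section ComplexIntegral.
Context {R : realType} (mu : probability (circle R) R).
Implicit Types f g : circle R -> R[i].

Definition Cbounded f := Cmeasurable f /\ exists K : R, forall z, `|f z| <= K%:C.

Lemma Cbounded_integrable f : Cbounded f ->
  mu.-integrable setT (EFin \o (fun z => complex.Re (f z))) /\
  mu.-integrable setT (EFin \o (fun z => complex.Im (f z))).
Proof.
move=> [[mr mi] [K fK]].
have fin : (mu setT < +oo)%E by rewrite [X in (X < _)%E]probability_setT ltry.
split; apply: measurable_bounded_integrable => //.
  exists K; split; first exact: num_real.
  move=> M KM z _ /=; have [h _] := Re_Im_norm_le (fK z).
  exact: le_trans h (ltW KM).
exists K; split; first exact: num_real.
move=> M KM z _ /=; have [_ h] := Re_Im_norm_le (fK z).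
exact: le_trans h (ltW KM).
Qed.

Lemma Cbounded_linear a f g : Cbounded f -> Cbounded g ->
  Cbounded (fun z => a * f z + g z).
Proof.
move=> [mf [K fK]] [mg [L gL]]; split.
  by apply: CmeasurableD => //; apply: CmeasurableM => //; exact: Cmeasurable_cst.
exists (complex.Re `|a| * K + L) => z; rewrite rmorphD rmorphM /=.
rewrite (le_trans (ler_normD _ _))// lerD// normrM.
have -> : (complex.Re `|a|)%:C = `|a| by apply: RRe_real; exact: normr_real.
by rewrite ler_wpM2l.
Qed.

Lemma Cbounded0 : Cbounded (fun=> 0).
Proof. by split; [exact: Cmeasurable_cst|exists 0 => z; rewrite normr0]. Qed.

Lemma Cintegral_linear a f g : Cbounded f -> Cbounded g ->
  Cintegral mu (fun z => a * f z + g z) = a * Cintegral mu f + Cintegral mu g.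
Proof.
move=> bf bg; have [fr fi] := Cbounded_integrable bf.
have [gr gi] := Cbounded_integrable bg.
have scale (b : R) (h : circle R -> R) : mu.-integrable setT (EFin \o h) ->
    mu.-integrable setT (EFin \o (fun z => b * h z)).
  move=> ih; rewrite (_ : _ \o _ = (fun z => b%:E * (EFin \o h) z)%E).
    exact: integrableZl.
  by apply/funext => z /=; rewrite EFinM.
case: a => x y; rewrite /Cintegral; apply/eqP; rewrite eq_complex /=.
apply/andP; split; apply/eqP.
  rewrite -!(RintegralZl _ measurableT)// -RintegralB//; try exact: scale.
  rewrite -RintegralD//.
    by apply: eq_Rintegral => z _; case: (f z) (g z) => [? ?] [].
  rewrite (_ : EFin \o _ = ((EFin \o (fun z => x * complex.Re (f z))%R) \-
      (EFin \o (fun z => y * complex.Im (f z))%R))%E); last by apply/funext.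
  by apply: integrableB => //; exact: scale.
rewrite -!(RintegralZl _ measurableT)// -RintegralD//; try exact: scale.
rewrite -RintegralD//.
  by apply: eq_Rintegral => z _; case: (f z) (g z) => [? ?] [].
rewrite (_ : EFin \o _ = ((EFin \o (fun z => x * complex.Im (f z))%R) \+
    (EFin \o (fun z => y * complex.Re (f z))%R))%E); last by apply/funext.
by apply: integrableD => //; exact: scale.
Qed.

Lemma Cintegral_sum (I : Type) (r : seq I) (a : I -> R[i])
    (f : I -> circle R -> R[i]) : (forall i, Cbounded (f i)) ->
  Cintegral mu (fun z => \sum_(i <- r) a i * f i z) =
  \sum_(i <- r) a i * Cintegral mu (f i).
Proof.
move=> bf; pose F r z := \sum_(i <- r) a i * f i z.
suff [] : Cbounded (F r) /\
  Cintegral mu (F r) = \sum_(i <- r) a i * Cintegral mu (f i) by [].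
elim: r => [|i r [b IH]].
  have -> : F [::] = fun=> 0 by apply/funext => z; rewrite /F big_nil.
  rewrite big_nil; split; first exact: Cbounded0.
  rewrite -[RHS](addNr (Cintegral mu (fun=> 0))) -mulN1r.
  rewrite -Cintegral_linear//; try exact: Cbounded0.
  by congr Cintegral; apply/funext => z; rewrite mulr0 addr0.
have -> : F (i :: r) = (fun z => a i * f i z + F r z).
  by apply/funext => z; rewrite /F big_cons.
by split; [exact: Cbounded_linear | rewrite Cintegral_linear// IH big_cons].
Qed.

Lemma Cintegral_conj f : Cbounded f ->
  Cintegral mu (fun z => (f z)^*) = (Cintegral mu f)^*.
Proof.
move=> bf; have [_ fi] := Cbounded_integrable bf.
rewrite /Cintegral; apply/eqP; rewrite eq_complex /=; apply/andP; split; apply/eqP.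
  by apply: eq_Rintegral => z _; case: (f z).
rewrite -mulN1r -(RintegralZl _ measurableT)//.
by apply: eq_Rintegral => z _; case: (f z) => ? ?; rewrite /= mulN1r.
Qed.

Lemma Cbounded_monomial i j :
  Cbounded (fun z : circle R => (z : R[i]) ^+ i * ((z : R[i]) ^+ j)^*).
Proof.
split; last first.
  by exists 1 => z; rewrite normrM norm_conjC !normrX norm_circle !expr1n mulr1.
have [mr mi] := @Cmeasurable_exp R j.
apply: CmeasurableM; [exact: Cmeasurable_exp | split].
  rewrite (_ : (fun z => _) = (fun z : circle R => complex.Re ((z : R[i]) ^+ j)))//.
  by apply/funext => z; case: (_ ^+ j).
rewrite (_ : (fun z => _) = (fun z : circle R => - complex.Im ((z : R[i]) ^+ j))).
  exact: measurable_funN.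
by apply/funext => z; case: (_ ^+ j).
Qed.

(** Since z * conj z = 1 on the circle, the Gram matrix of the monomials is Toeplitz, with the
    moments as entries. *)
Lemma Cintegral_monomial i j :
  Cintegral mu (fun z : circle R => (z : R[i]) ^+ i * ((z : R[i]) ^+ j)^*) =
  if (j <= i)%N then Cintegral mu (fun z : circle R => (z : R[i]) ^+ (i - j))
  else (Cintegral mu (fun z : circle R => (z : R[i]) ^+ (j - i)))^*.
Proof.
have zz (z : circle R) k : (z : R[i]) ^+ k * ((z : R[i]) ^+ k)^* = 1.
  by rewrite -normCK normrX norm_circle !expr1n.
case: leqP => ij.
  by congr Cintegral; apply/funext => z; rewrite -{1}(subnK ij) exprD -mulrA zz mulr1.
rewrite -Cintegral_conj; last first.
  rewrite (_ : (fun z => _) =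
      fun z : circle R => (z : R[i]) ^+ (j - i) * ((z : R[i]) ^+ 0)^*).
    exact: Cbounded_monomial.
  by apply/funext => z; rewrite expr0 rmorph1 mulr1.
congr Cintegral; apply/funext => z.
by rewrite -{1}(subnK (ltnW ij)) exprD rmorphM /= mulrCA zz mulr1.
Qed.

Lemma Cintegral_horner a b (p q : {poly R[i]}) : (size p <= a)%N -> (size q <= b)%N ->
  Cintegral mu (fun z : circle R => p.[z : R[i]] * (q.[z : R[i]])^*) =
  \sum_(i < a) \sum_(j < b) p`_i * (q`_j)^* *
    Cintegral mu (fun z : circle R => (z : R[i]) ^+ i * ((z : R[i]) ^+ j)^*).
Proof.
move=> pa qb.
pose pq (ij : 'I_a * 'I_b) := p`_ij.1 * (q`_ij.2)^*.
rewrite pair_big /= -(Cintegral_sum _ pq); last first.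
  by move=> ij; exact: Cbounded_monomial.
congr Cintegral; apply/funext => z.
rewrite (horner_coef_wide _ pa) (horner_coef_wide _ qb) rmorph_sum.
rewrite big_distrlr /= pair_big /=.
by apply: eq_bigr => ij _; rewrite /pq rmorphM /= mulrACA.
Qed.

End ComplexIntegral.

(** * The compressed multiplication model *)

Section Model.
Context {R : realType} {H : vectType R[i]} (dot : {dot H for (@conjC R[i])}).
Variables (A : 'End(H)) (s : {scalar H}) (n : nat).
Hypothesis sE : forall x y, dot x y - dot (A x) (A y) = s x * (s y)^*.
Hypothesis dimH : \dim {:H} = n.+1.
Variable v : H.
Hypothesis sv0 : forall k, (k < n)%N -> s (iter k A v) = 0.
Hypothesis sv_neq0 : s (iter n A v) != 0.
Variable mu : probability (circle R) R.
Hypothesis mu_moment : forall k, (k <= n.+1)%N ->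
  Cintegral mu (fun z => (z : R[i]) ^+ k) = moment dot A v k.

(** A preserves an inner product as soon as s kills one of the two vectors. As s (A^k v) = 0 for k <
    n, the j common factors A cancel one by one. *)
Lemma dot_iter_moment i j : (j <= i)%N -> (j <= n)%N ->
  dot (iter i A v) (iter j A v) = moment dot A v (i - j).
Proof.
elim: j i => [|j IH] [|i] //= ji jn; rewrite subSS -IH//; last exact: ltnW.
have := sE (iter i A v) (iter j A v); rewrite (sv0 jn) rmorph0 mulr0 => /eqP.
by rewrite subr_eq0 => /eqP <-.
Qed.

(** Both sides are sesquilinear with the same Gram entries on monomials. Degree n + 1 is allowed for
    p so that z times an element of [{poly_n.+1 R[i]}] is covered. *)
Lemma dot_polyact_integral (p q : {poly R[i]}) :
  (size p <= n.+2)%N -> (size q <= n.+1)%N ->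
  Cintegral mu (fun z : circle R => p.[z : R[i]] * (q.[z : R[i]])^*) =
  dot (polyact A p v) (polyact A q v).
Proof.
move=> sp sq; rewrite (Cintegral_horner _ sp sq) (polyactE _ _ sp) (polyactE _ _ sq).
rewrite dot_suml; apply: eq_bigr => i _; rewrite dotZl dot_sumr mulr_sumr.
apply: eq_bigr => j _; rewrite dotZr mulrA; congr (_ * _).
have [iN jN] := (ltn_ord i, ltn_ord j).
rewrite Cintegral_monomial; case: leqP => ij.
  rewrite mu_moment; first by rewrite dot_iter_moment.
  by rewrite (leq_trans (leq_subr _ _)).
rewrite mu_moment; last by rewrite (leq_trans (leq_subr _ _))// ltnW.
rewrite [RHS]dotC dot_iter_moment//; first exact: ltnW.
by rewrite -ltnS (leq_trans ij)// ltnW.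
Qed.

(** Multiplying by X^d moves the leading coefficient of p to degree n, where s reads it off times
    the nonzero s (A^n v). *)
Lemma polyact_cyclic_inj (p : {poly R[i]}) :
  (size p <= n.+1)%N -> polyact A p v = 0 -> p = 0.
Proof.
move=> sp pv0; apply/eqP/negPn/negP => p0.
pose d := (n.+1 - size p)%N.
have sq : (size (p * 'X^d)%R <= n.+1)%N.
  by rewrite size_mulXn// /d subnK.
have := scalar_polyact A s v sq; rewrite mulrC polyactM pv0 polyactr0 linear0.
rewrite big_ord_recr big1 /= => [|i _]; last by rewrite sv0 ?mulr0.
rewrite add0r coefXnM => /esym/eqP; rewrite mulf_eq0 (negPf sv_neq0) orbF.
have s0 : (0 < size p)%N by rewrite size_poly_gt0.
rewrite ifF; last by rewrite /d; lia.
have -> : (n - d = (size p).-1)%N by rewrite /d; lia.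
by rewrite -lead_coefE lead_coef_eq0 (negPf p0).
Qed.

Lemma cyclic_model : exists2 V : 'Hom({poly_n.+1 R[i]}, H),
  (forall p, V p = polyact A p v) & lker V == 0%VS /\ limg V = fullv.
Proof.
pose V0 (p : {poly_n.+1 R[i]}) := polyact A p v.
have lin : linear V0 by move=> a p q; rewrite /V0 /= polyact_semilinear.
pose lin' := GRing.isLinear.Build _ _ _ _ V0 lin.
pose V := linfun (HB.pack V0 lin' : {linear {poly_n.+1 R[i]} -> H}).
have VE p : V p = polyact A p v by rewrite lfunE.
exists V => //; have V_inj : lker V == 0%VS.
  apply/lker0P => p q; rewrite !VE => pq; apply: val_inj => /=.
  apply/eqP; rewrite -subr_eq0; apply/eqP/polyact_cyclic_inj.
    by rewrite (leq_trans (size_polyD _ _))// size_polyN geq_max !size_npoly.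
  by rewrite polyactB pq subrr.
split=> //; apply/eqP; rewrite eqEdim subvf limg_dim_eq ?(eqP V_inj) ?capv0//.
by rewrite dimH dim_polyn /=.
Qed.

(** Under p -> p(A) v, orthogonality to [{poly_n.+1 R[i]}] becomes orthogonality to all of H, so the
    projection of f is the polynomial that represents p(A) v. As r has this property, the default of
    [xget] is excluded. *)
Lemma Pn_polyact (f : L2 mu) (p : {poly R[i]}) (r : {poly_n.+1 R[i]}) :
    (forall z, f z = p.[z : R[i]]) -> (size p <= n.+2)%N ->
  polyact A r v = polyact A p v -> Pn n.+1 f = r.
Proof.
move=> fp sp rp; have [V VE [V_inj V_surj]] := cyclic_model.
have dotE (r' q : {poly_n.+1 R[i]}) :
    L2dot mu (fun z => f z - L2_of_poly mu r' z) (L2_of_poly mu q) =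
    dot (polyact A r v - V r') (V q).
  have sd : (size (p - val r')%R <= n.+2)%N.
    rewrite (leq_trans (size_polyD _ _))// size_polyN geq_max sp /=.
    exact: leq_trans (size_npoly _) (leqnSn _).
  rewrite !VE rp -polyactB -(dot_polyact_integral sd (size_npoly q)) /L2dot.
  by congr Cintegral; apply/funext => z /=; rewrite fp hornerD hornerN.
rewrite /Pn; case: xgetP => [r' _ /= r'P|/(_ r) []] /=; last first.
  by move=> q; rewrite dotE VE subrr linear0l.
(* Testing against the preimage W of the difference itself makes its norm 0. *)
have [W VW] : exists W, V W = polyact A r v - V r'.
  have := limg_lfunVK (_ : polyact A r v - V r' \in limg V).
  by rewrite V_surj memvf => /(_ isT) <-; eexists.
have := r'P W; rewrite dotE VW => /eqP; rewrite dnorm_eq0 subr_eq0 -VE => /eqP.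
by move=> e; apply/esym; move: e; apply/lker0P.
Qed.

(** The unitary is the inverse of p -> p(A) v: the projection of z p is the polynomial representing
    A p(A) v. *)
Lemma unitarily_equivalent_compressed_mult :
  unitarily_equivalent dot (@poly_dot R mu n.+1) A (@compressed_mult R mu n.+1).
Proof.
have [V VE [V_inj V_surj]] := cyclic_model.
have VK : cancel V (V^-1)%VF by exact: lker0_lfunK.
have VVK : cancel (V^-1)%VF V by move=> x; rewrite limg_lfunVK// V_surj memvf.
exists (V^-1)%VF; split; first by exists V.
  move=> x y; rewrite -[x in RHS]VVK -[y in RHS]VVK !VE.
  by rewrite -(dot_polyact_integral (leq_trans (size_npoly _) (leqnSn _)) (size_npoly _)).
move=> x; set p := (V^-1)%VF x.
have Pp : Pn n.+1 (L2_of_poly mu p) = p.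
  apply: (@Pn_polyact _ p) => //; exact: leq_trans (size_npoly _) (leqnSn _).
rewrite /compressed_mult Pp; apply/esym; apply: (@Pn_polyact _ (val p * 'X)).
- by move=> z /=; rewrite hornerMX mulrC.
- rewrite (leq_trans (size_polyMleq _ _))// size_polyX addnC /=.
  by rewrite ltnS size_npoly.
- by rewrite polyactMX -!VE !VVK.
Qed.

End Model.

Theorem theorem2 (R : realType) (n : nat) (hn : (1 <= n)%N)
    (H : vectType R[i]) (dot : {dot H for (@Num.conj R[i])}%R) (A : 'End(H))
    (hA : in_S dot n A) :
  exists2 mu : probability (circle R) R, nontrivial mu &
    unitarily_equivalent dot (@poly_dot R mu n) A (@compressed_mult R mu n).
Proof.
case: n hn hA => // n _ [dimH cA cnuA dA].
have [s sE] := defect_functional cA dA.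
have [v [v1 sv0 sv_neq0]] := last_observed_unit_vector sE cnuA dimH.
(* The model uses the moments c_0, ..., c_(n+1), where n + 1 is the dimension, and the measure
   matches those of index below N. *)
have [N nN herglotz_gt0] := herglotz_sum_gt0 sE cnuA dimH v1 sv0 sv_neq0 n.+2.
have [||mu mu_nt mu_moment] :=
  herglotz_moment_measure (c := moment dot A v) _ _ herglotz_gt0.
- exact: v1.
- exact: leq_trans nN.
exists mu => //.
apply: (unitarily_equivalent_compressed_mult sE dimH sv0 sv_neq0) => k kn.
by rewrite mu_moment// (leq_trans _ nN).
Qed.
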